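(* Let $H$ be the additive subgroup of $\mathbb{R}^{n}$ generated by vectors $u_{1},\dots,u_{m}$, labelled so that $u_1,\dots,u_q$ is a basis of $\mathrm{vect}(H)$, where $q=\dim(\mathrm{vect}(H))$. Then $\widetilde{\mathrm{dim}}(\overline{H})=L(M_{H})+i\,(q-L(M_{H}))$.
   Context: $\mathrm{vect}(A)$ denotes the real span of $A\subset\mathbb{R}^n$; $\overline{H}$ the closure of $H$. Complex dimension: for an additive subgroup $G$ of $\mathbb{R}^n$, $\widetilde{\mathrm{dim}}(G):=p+i(s-p)$ where $p=\max\{\dim V: V\text{ a vector subspace},\ V\subset G\}$ and $s=\dim \mathrm{vect}(G)$. Definition of $L(M_H)$ for an ordered generating family $u_1,\dots,u_m$ of $H$ whose first $q$ members form a basis of $\mathrm{vect}(H)$: for each $k=q+1,\dots,m$ write $u_k=\sum_{j=1}^{q}\alpha_{k,j}u_j$ with $\alpha_{k,j}\in\mathbb{R}$. Choose $I_k\subset\{1,\dots,q\}$ such that $\{1\}\cup\{\alpha_{k,i}: i\in I_k\}$ is a longest sublist of $1,\alpha_{k,1},\dots,\alpha_{k,q}$ that is linearly independent over $\mathbb{Q}$ (containing $1$). Then for each $j\notin I_k$ there are rationals $t_{k,j}$ and $\gamma^{(k)}_{j,i}$ ($i\in I_k$) with $\alpha_{k,j}=t_{k,j}+\sum_{i\in I_k}\gamma^{(k)}_{j,i}\alpha_{k,i}$. Choose $N\in\mathbb{N}^*$ with $N\gamma^{(k)}_{i,j}=:m^{(k)}_{i,j}\in\mathbb{Z}$ for all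 relevant indices, and set, for $q+1\le k\le m$ and $j\in I_k$, $u'_{k,j}=Nu_j+\sum_{i\notin I_k} m^{(k)}_{i,j}u_i$. $M_H$ is the matrix whose columns are all the vectors $u'_{k,j}$ ($q+1\le k\le m$, $j\in I_k$), and $L(M_H)=\mathrm{rank}(M_H)$ (the dimension of the span of the $u'_{k,j}$; it is $0$ if there are none). *)

(* Defs.v *)
(* Vectors of R^n are row vectors 'rV[R]_n,
   with the product topology of matrix_topology. *)
From HB Require Import structures.
From mathcomp Require Import all_boot all_order all_algebra.
From mathcomp Require Import all_classical all_reals all_analysis.
Set Implicit Arguments. Unset Strict Implicit. Unset Printing Implicit Defensive.
Import Order.TTheory GRing.Theory Num.Theory.
Import numFieldNormedType.Exports.
Local Open Scope ring_scope.
Local Open Scope classical_set_scope.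

Section Defs.
Variables (R : realType) (n : nat).

Definition subspace_in (V : 'M[R]_n) (G : set 'rV[R]_n) :=
  forall v : 'rV[R]_n, (v <= V)%MS -> G v.

Definition max_subspace_dim (G : set 'rV[R]_n) : nat :=
  (\max_(k < n.+1 | `[< exists V : 'M[R]_n, \rank V = k /\ subspace_in V G >]) k)%N.

Definition dim_vect (G : set 'rV[R]_n) : nat :=
  \big[minn/n]_(k < n.+1 | `[< exists V : 'M[R]_n, \rank V = k /\
                               (forall v, G v -> (v <= V)%MS) >]) k.

(* complex dimension p + i (s - p), represented as the pair (p, s - p) of integers *)
Definition cdim (G : set 'rV[R]_n) : int * int :=
  ((max_subspace_dim G)%:Z, (dim_vect G)%:Z - (max_subspace_dim G)%:Z).

(* additive subgroup generated by u_1..u_q, w_1..w_r  (w_k = u_{q+k}) *)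
Definition gen_subgroup q r (u : 'I_q -> 'rV[R]_n) (w : 'I_r -> 'rV[R]_n)
  : set 'rV[R]_n :=
  [set x | exists (a : 'I_q -> int) (b : 'I_r -> int),
      x = \sum_(j < q) u j *~ a j + \sum_(k < r) w k *~ b k].

End Defs.

Definition Qfree_with1 (R : realType) q (S : {set 'I_q}) (a : 'I_q -> R) :=
  forall (c0 : rat) (c : 'I_q -> rat),
    ratr c0 + \sum_(i in S) ratr (c i) * a i = 0 ->
    c0 = 0 /\ (forall i, i \in S -> c i = 0).

Definition uprime (R : realType) n q r (u : 'I_q -> 'rV[R]_n) (I : 'I_r -> {set 'I_q})
  (N : nat) (mm : 'I_r -> 'I_q -> 'I_q -> int) (k : 'I_r) (j : 'I_q) : 'rV[R]_n :=
  N%:R *: u j + \sum_(i < q | i \notin I k) (mm k i j)%:~R *: u i.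

Definition LMH (R : realType) n q r (u : 'I_q -> 'rV[R]_n) (I : 'I_r -> {set 'I_q})
  (N : nat) (mm : 'I_r -> 'I_q -> 'I_q -> int) : nat :=
  \rank (\sum_(k < r) \sum_(j in I k) <<uprime u I N mm k j>>)%MS.

(* Main.v *)
Require Import Defs.
From HB Require Import structures.
From mathcomp Require Import all_boot all_order all_algebra.
From mathcomp Require Import all_classical all_reals all_analysis.
From mathcomp Require Import ring lra.
Import Order.TTheory GRing.Theory Num.Theory.
Import numFieldNormedType.Exports.
Local Open Scope ring_scope.
Local Open Scope classical_set_scope.

(* In the coordinates of u_1, ..., u_q, let G be the closure of H. By the duality for
   closed subgroups of R^q, the largest subspace contained in G is the common kernel of
   the linear forms that are integral on G. These forms are the integer vectors y with
   <y, alpha_k> integral for every k. Since 1 and the alpha_{k,j} with j in I_k are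
   independent over Q, such a y satisfies
   y_j + sum_(i notin I_k) gamma_{i,j} y_i = 0 for j in I_k, which says that y kills the
   vectors u'_{k,j}. Conversely, every rational y killing these vectors becomes such a
   form after clearing denominators. The vectors u'_{k,j} have rational coordinates, so
   their span is cut out by rational forms, and is therefore this largest subspace. *)

(** * Additive subgroups and integer combinations *)

Definition is_subgroup (V : zmodType) (K : set V) :=
  K 0 /\ forall x y, K x -> K y -> K (x - y).

Section Subgroup.
Variables (V : zmodType) (K : set V).
Hypothesis hK : is_subgroup V K.

Lemma subgroupN x : K x -> K (- x).
Proof. by move=> Kx; rewrite -sub0r; apply: hK.2 => //; exact: hK.1. Qed.

Lemma subgroupD x y : K x -> K y -> K (x + y).
Proof. by move=> Kx Ky; rewrite -[y]opprK; apply: hK.2 => //; exact: subgroupN. Qed.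

Lemma subgroup_mulz x (m : int) : K x -> K (x *~ m).
Proof.
move=> Kx; have Kn k : K (x *+ k).
  elim: k => [|k IH]; first by rewrite mulr0n; exact: hK.1.
  by rewrite mulrS; exact: subgroupD.
by case: m => k; [exact: Kn | rewrite NegzE mulrNz; exact/subgroupN/Kn].
Qed.

Lemma subgroup_sum (J : Type) (s : seq J) (F : J -> V) :
  (forall j, K (F j)) -> K (\sum_(j <- s) F j).
Proof. by move=> KF; apply: big_ind; [exact: hK.1|exact: subgroupD|]. Qed.

End Subgroup.

(** * Closures in terms of norms, and continuity of matrix multiplication *)

Section NormClosure.
Variable R : realType.

Lemma invSn_lt (e : R) : 0 < e -> exists m : nat, m.+1%:R^-1 < e.
Proof.
move=> e0; exists (Num.truncn e^-1); rewrite invf_plt ?posrE//.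
exact: truncnS_gt.
Qed.

Lemma closure_normP (V : normedModType R) (A : set V) x :
  closure A x <-> forall e : R, 0 < e -> exists g, A g /\ `|x - g| < e.
Proof.
split=> [clx e e0|H B].
  have [g [Ag xg]] := clx _ (nbhsx_ballx x e e0).
  by exists g; split=> //; move: xg; rewrite -ball_normE.
rewrite -nbhs_ballE => -[e /= e0 sB]; have [g [Ag xg]] := H _ e0.
by exists g; split=> //; apply: sB; rewrite -ball_normE.
Qed.

Lemma is_subgroup_closure (V : normedModType R) (A : set V) :
  is_subgroup V A -> is_subgroup V (closure A).
Proof.
move=> [A0 AB]; split; first exact: subset_closure.
move=> x y /closure_normP clx /closure_normP cly; apply/closure_normP => e e0.
have e2 : 0 < e / 2 by rewrite divr_gt0.
have [[g [Ag xg]] [h [Ah yh]]] := (clx _ e2, cly _ e2).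
exists (g - h); split; first exact: AB.
rewrite opprB addrACA [- y + _]addrC addrACA addrC.
have -> : h - y + (x - g) = (x - g) - (y - h) by rewrite addrC opprB.
by rewrite (le_lt_trans (ler_normB _ _)) // [ltRHS]splitr ltrD.
Qed.

Lemma mx_entry_le_norm m n (x : 'M[R]_(m, n)) i j : `|x i j| <= `|x|.
Proof. by rewrite [leRHS]mx_normrE (le_bigmax _ _ (i, j)). Qed.

Lemma mx_norm_ltP m n (x : 'M[R]_(m, n)) e : 0 < e ->
  (`|x| < e) <-> (forall i j, `|x i j| < e).
Proof.
move=> e0; split=> [xe i j|xe]; first exact: le_lt_trans (mx_entry_le_norm _ _ _ _ _) xe.
by rewrite [ltLHS]mx_normrE; apply/bigmax_ltP; split=> // -[i j] _; exact: xe.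
Qed.

Lemma mulmx_norm_bound m n (M : 'M[R]_(m, n)) :
  exists2 C : R, 0 < C & forall x : 'rV_m, `|x *m M| <= C * `|x|.
Proof.
(* The summand 1 keeps the constant positive even for [M = 0], so that it can be divided by. *)
exists (1 + \sum_i \sum_j `|M i j|).
  by rewrite ltr_pwDl// sumr_ge0// => i _; rewrite sumr_ge0.
move=> x; rewrite [leLHS]mx_normrE; apply/bigmax_leP; split => [|[i j] _ /=].
  by rewrite mulr_ge0// addr_ge0// sumr_ge0// => i _; rewrite sumr_ge0.
rewrite mxE (le_trans (ler_norm_sum _ _ _))// mulrDl mul1r.
rewrite mulr_suml ler_wpDl// ler_sum// => l _; rewrite normrM mulrC ler_pM//.
  by rewrite (bigD1 j)//= lerDl sumr_ge0.
exact: mx_entry_le_norm.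
Qed.

Lemma closure_mulmx m n (H : set 'rV[R]_m) (M : 'M[R]_(m, n)) x (e : R) :
  closure H x -> 0 < e -> exists2 g, H g & `|x *m M - g *m M| < e.
Proof.
move=> /closure_normP clx e0; have [C C0 MC] := mulmx_norm_bound _ _ M.
have [g [Hg xg]] := clx _ (divr_gt0 e0 C0); exists g => //.
by rewrite -mulmxBl (le_lt_trans (MC _))// -ltr_pdivlMl// mulrC.
Qed.

End NormClosure.

Lemma mx_mulrz (R : pzRingType) m n (M : 'M[R]_(m, n)) (z : int) i j :
  (M *~ z) i j = M i j * z%:~R.
Proof. by rewrite -scaler_int mxE mulrzl mulrzr. Qed.

Lemma col_mulmx (R : pzSemiRingType) m n p (A : 'M[R]_(m, n)) (B : 'M[R]_(n, p)) j :
  col j (A *m B) = A *m col j B.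
Proof. by apply/colP => i; rewrite !mxE; apply: eq_bigr => l _; rewrite mxE. Qed.

(** * Structure of closed subgroups of real row vectors, and their duality *)

Section DiscreteSubgroup.
Variables (R : realType) (s : nat) (K : set 'rV[R]_s).
Hypothesis subK : is_subgroup _ K.

(* Otherwise the directions of ever shorter elements of K accumulate at a unit
   vector z, and integer multiples of these elements approximate all of R z. *)
Lemma closed_subgroup_no_line_discrete :
  closed K -> (forall z, (forall t : R, K (t *: z)) -> z = 0) ->
  exists2 d : R, 0 < d & forall z, K z -> `|z| < d -> z = 0.
Proof.
move=> clK noline; apply: contrapT => ndisc.
have small (k : nat) : exists z, [/\ K z, z != 0 & `|z| < k.+1%:R^-1].
  apply: contrapT => nz; apply: ndisc; exists k.+1%:R^-1; first by rewrite invr_gt0.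
  move=> z Kz zk; apply: contrapT => /eqP z0; apply: nz; by exists z.
have [z zP] := choice small.
pose zn k := `|z k|^-1 *: z k.
have zn1 k : `|zn k| = 1.
  have [_ z0 _] := zP k.
  by rewrite normrZ ger0_norm ?invr_ge0// mulVf// normr_eq0.
(* The normalised vectors [zn k] lie in a compact cube, which supplies the cluster point [x]. *)
have cpt : compact [set x : 'rV[R]_s | forall i, `[-1, 1]%classic (x ord0 i)].
  have := @rV_compact R s (fun=> `[-1, 1]%classic).
  by apply=> i; exact: segment_compact.
have [|x [_ clx]] := cpt (zn @ \oo) _.
  exists 0%N => // k _ i /=; rewrite in_itv/= -ler_norml -(zn1 k); exact: mx_entry_le_norm.
have approx (e : R) (m : nat) : 0 < e -> exists k, (m <= k)%N /\ `|x - zn k| < e.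
  move=> e0; have [|_ [[k mk <-]]] := clx (zn @` [set k | (m <= k)%N]) _ _ (nbhsx_ballx x e e0).
    by exists m => // k mk; exists k.
  by rewrite -ball_normE /= => xk; exists k.
have x0 : x != 0.
  apply/eqP => x0; have [//|k [_]] := approx 1 0%N.
  by rewrite x0 sub0r normrN zn1 ltxx.
move/eqP: x0; apply; apply: noline => t.
rewrite (closure_id K).1//; apply/closure_normP => e e0.
(* Scaled so that [|t| * e'] is at most [e / 2]; the [+ 1] allows [t = 0]. *)
pose e' := e / (`|t| + 1) / 2.
have e'0 : 0 < e' by rewrite !divr_gt0// ltr_wpDl.
have [m me] : exists m : nat, m.+1%:R^-1 < e / 2.
  by apply: invSn_lt; rewrite divr_gt0.
have [k [mk xk]] := approx _ m e'0.
have [Kz z0 zk] := zP k; have nz0 : 0 < `|z k| by rewrite normr_gt0.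
(* Rounding [t / |z k|] down costs at most one copy of [z k], whose norm is below [e / 2]. *)
exists (z k *~ Num.floor (t / `|z k|)); split; first exact: subgroup_mulz.
have -> : t *: x - z k *~ Num.floor (t / `|z k|) =
   t *: (x - zn k) + (t / `|z k| - (Num.floor (t / `|z k|))%:~R) *: z k.
  rewrite scalerBr scalerBl /zn scalerA -scaler_int addrA subrK; congr (_ - _).
rewrite (le_lt_trans (ler_normD _ _))// [ltRHS]splitr ler_ltD//.
  rewrite normrZ (le_trans (ler_wpM2l _ (ltW xk)))// /e'.
  rewrite mulrA ler_pM2r ?invr_gt0// mulrA ler_pdivrMr ?ltr_wpDl//.
  by rewrite mulrC ler_pM2l// lerDl.
rewrite normrZ (@le_lt_trans _ _ (1 * `|z k|))//.
  rewrite ler_wpM2r// ler_norml; apply/andP.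
  by have := floor_itv (t / `|z k|); rewrite intrD; lra.
by rewrite mul1r (lt_trans zk)// (le_lt_trans _ me)// lef_pV2 ?posrE// ler_nat ltnS.
Qed.

Hypothesis stdK : forall i, K (delta_mx 0 i).

(** Pigeonhole: among sufficiently many multiples of [z], two agree modulo integer vectors up to
    less than [d]. Their reduced difference lies in [K], hence vanishes, so a bounded positive
    multiple of [z] is integral. *)
Lemma discrete_subgroup_denominator (d : R) : 0 < d ->
  (forall z, K z -> `|z| < d -> z = 0) ->
  exists2 D : nat, (0 < D)%N & forall z i, K z -> D%:R * z 0 i \is a Num.int.
Proof.
move=> d0 disc.
have [M' Md] := invSn_lt _ _ d0; pose M := M'.+1.
have M0 : 0 < M%:R :> R by rewrite ltr0n.
(* [T] indexes the subcubes of side [1 / M] of the unit cube, where [1 / M < d]. *)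
pose T := {ffun 'I_s -> 'I_M}.
(* The multiplier found for [z] is between 1 and [#|T|], so it divides this factorial, which does
   not depend on [z]. *)
exists (#|T|)`!; first exact: fact_gt0.
move=> z i Kz.
pose fr (x : R) := x - (Num.floor x)%:~R.
have fr01 x : 0 <= fr x < 1 by have := floor_itv x; rewrite intrD /fr; lra.
pose cell (j : 'I_#|T|.+1) : T :=
  [ffun l => inord (Num.truncn (M%:R * fr (j%:R * z 0 l)))].
have cellP (j : 'I_#|T|.+1) l :
    (cell j l)%:R <= M%:R * fr (j%:R * z 0 l) < (cell j l)%:R + 1.
  have /andP[f0 f1] := fr01 (j%:R * z 0 l).
  have /truncn_itv/andP[t0 t1] : 0 <= M%:R * fr (j%:R * z 0 l).
    by rewrite mulr_ge0// ltW.
  rewrite ffunE inordK ?t0 ?natr1//.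
  rewrite -(ltr_nat R) (le_lt_trans t0)// -[ltRHS]mulr1 ltr_pM2l//.
have /injectivePn[j1 [j2 j12 cj]] : ~~ injectiveb cell.
  apply/negP => /injectiveP/leq_card; by rewrite card_ord ltnn.
wlog lt12 : j1 j2 j12 cj / (j1 < j2)%N.
  move=> W; case: (ltngtP j1 j2) => [|/W|/val_inj/eqP e]; first exact: W.
    by apply=> //; rewrite eq_sym.
  by rewrite e in j12.
pose y := \row_l (fr (j2%:R * z 0 l) - fr (j1%:R * z 0 l)).
have Ky : K y.
  have -> : y = z *~ (j2 - j1)%N -
      \sum_l delta_mx 0 l *~ (Num.floor (j2%:R * z 0 l) - Num.floor (j1%:R * z 0 l)).
    apply/rowP => l; rewrite 3!mxE summxE (bigD1 l)//= big1 => [|l' l'l].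
      rewrite !mx_mulrz !mxE !eqxx addr0 mul1r /fr -pmulrn natrB ?(ltnW lt12)// intrB.
      ring.
    by rewrite mx_mulrz mxE eq_sym (negbTE l'l) mul0r.
  apply: subK.2; first exact: subgroup_mulz.
  by apply: subgroup_sum => // l; apply: subgroup_mulz.
have y0 : y = 0.
  apply: disc => //; apply/mx_norm_ltP => // i' l; rewrite mxE.
  rewrite (lt_le_trans _ (ltW Md))// -[ltRHS]mul1r ltr_pdivlMr// -[X in _ * X]gtr0_norm// -normrM.
  have := cellP j1 l; have := cellP j2 l; rewrite cj ltr_norml.
  by rewrite mulrBl ![fr _ * M%:R]mulrC; lra.
have : (j2 - j1)%N%:R * z 0 i \is a Num.int.
  have /rowP/(_ i) := y0; rewrite !mxE /fr natrB ?(ltnW lt12)// => e.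
  have -> : (j2%:R - j1%:R) * z 0 i =
     (Num.floor (j2%:R * z 0 i) - Num.floor (j1%:R * z 0 i))%:~R.
    by rewrite intrB; lra.
  exact: intr_int.
have /dvdnP[c ->] : (j2 - j1 %| (#|T|)`!)%N.
  apply: dvdn_fact; rewrite subn_gt0 lt12/= (leq_trans (leq_subr _ _))//.
  by rewrite -ltnS.
by move=> ?; rewrite natrM -mulrA rpredM// rpred_nat.
Qed.

End DiscreteSubgroup.

(* Modulo a maximal subspace V of G, the group becomes a discrete group containing
   a lattice, so multiples of the coordinate forms are integral on G and cut out V. *)
Lemma closed_subgroup_dual (R : realType) (q : nat) (G : set 'rV[R]_q) :
  is_subgroup _ G -> closed G -> (forall i, G (delta_mx 0 i)) ->
  forall x : 'rV[R]_q,
    (forall y : 'cV[R]_q, (forall g, G g -> (g *m y) 0 0 \is a Num.int) -> x *m y = 0) ->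
  G x.
Proof.
move=> subG clG stdG x xy.
pose P k := `[< exists V : 'M[R]_q, \rank V = k /\ subspace_in V G >].
have exP : exists k, P k.
  exists 0%N; apply/asboolP; exists 0; rewrite mxrank0; split => // v.
  by rewrite submx0 => /eqP ->; exact: subG.1.
have boundP k : P k -> (k <= q)%N by move=> /asboolP[V [<- _]]; exact: rank_leq_row.
have [k /asboolP[V [rV VG]] maxV] := ex_maxnP exP boundP.
(* The standard vectors forming the rows of [E] span a complement of [V], and [C] reads off
   coordinates modulo [V] along it. *)
set s := \rank (cokermx V); pose f := maxrankfun (cokermx V).
pose E : 'M[R]_(s, q) := rowsub f 1%:M.
pose B := rowsub f (cokermx V).
pose C : 'M[R]_(q, s) := cokermx V *m pinvmx B.
have BE : B = E *m cokermx V by rewrite /B rowsubE.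
have EC : E *m C = 1%:M by rewrite mulmxA -BE mulmxVp// maxrowsub_free.
have kerC v : v *m C = 0 -> (v <= V)%MS.
  move=> vC; rewrite submxE -[v *m _](@mulmxKpV _ _ _ _ _ B).
    by rewrite -(mulmxA v) vC mul0mx.
  by rewrite eq_maxrowsub submxMl.
pose K := [set z | G (z *m E)].
have subK : is_subgroup _ K.
  split; first by rewrite /K /= mul0mx; exact: subG.1.
  by move=> a b Ka Kb; rewrite /K/= mulmxBl; exact: subG.2.
have clK : closed K.
  move=> z Kz; rewrite /K/= (closure_id G).1//; apply/closure_normP => e e0.
  by have [g Kg zg] := closure_mulmx _ _ _ _ E _ _ Kz e0; exists (g *m E).
have stdK i : K (delta_mx 0 i).
  by rewrite /K/= -rowE row_rowsub row1.
(* A line in [K] would enlarge [V] inside [G], against maximality. *)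
have noline z : (forall t : R, K (t *: z)) -> z = 0.
  move=> lineK.
  have V'G : subspace_in (V + z *m E)%MS G.
    move=> v /sub_addsmxP[[a b] /= ->]; apply: subgroupD => //.
      by apply: VG; rewrite submxMl.
    by rewrite [b]mx11_scalar mul_scalar_mx scalemxAl; exact: lineK.
  have : (\rank (V + z *m E)%MS <= \rank V)%N.
    by rewrite rV; apply: maxV; apply/asboolP; exists (V + z *m E)%MS.
  rewrite (geq_leqif (mxrank_leqif_sup (addsmxSl _ _))) addsmx_sub => /andP[_].
  rewrite submxE -mulmxA -BE => /eqP zB0.
  by rewrite -[z](@mulmxKp _ _ _ _ B) ?zB0 ?mul0mx// maxrowsub_free.
have [d d0 disc] := closed_subgroup_no_line_discrete _ _ _ subK clK noline.
have [D D0 DK] := discrete_subgroup_denominator _ _ _ subK stdK _ d0 disc.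
apply/VG/kerC/rowP => i.
(* For [g] in [G], the vector [g - g *m C *m E] lies in [V], hence in [G]; so [g *m C] is in [K] and
   [D] clears its denominators. *)
have /xy/matrixP/(_ 0 0) : forall g, G g -> (g *m (D%:R *: col i C)) 0 0 \is a Num.int.
  move=> g Gg; rewrite -scalemxAr -col_mulmx 2!mxE; apply: DK.
  rewrite /K/= -[_ *m E](subKr g); apply: subG.2 => //; apply/VG/kerC.
  by rewrite mulmxBl -mulmxA EC mulmx1 subrr.
rewrite -scalemxAr -col_mulmx !mxE => /eqP; rewrite mulf_eq0 pnatr_eq0.
by rewrite (gtn_eqF D0) => /eqP.
Qed.

(** * Linear conditions that pass from a subgroup to its closure *)

Section ClosureFunctionals.
Variables (R : realType) (n : nat).
Implicit Types (H : set 'rV[R]_n) (V : 'M[R]_n).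

(** Membership in [V] is the vanishing of the continuous map given by [cokermx V], a closed
    condition. *)
Lemma closure_submx H V : (forall v, H v -> (v <= V)%MS) ->
  forall v, closure H v -> (v <= V)%MS.
Proof.
move=> HV v clv; rewrite submxE -normr_le0 leNgt; apply/negP => v0.
have [g /HV] := closure_mulmx _ _ _ _ (cokermx V) _ _ clv v0.
by rewrite submxE => /eqP ->; rewrite subr0 ltxx.
Qed.

Lemma dim_vect_closure H : dim_vect (closure H) = dim_vect H.
Proof.
apply: eq_bigl => k; apply/asbool_equiv_eq; split=> -[V [rV HV]]; exists V; split=> //.
  by move=> v Hv; apply/HV/subset_closure.
exact: closure_submx.
Qed.

(* An integral form cannot take the value 1/2 on the closure. *)
Lemma int_form_line_closure H (y : 'cV[R]_n) v :
  (forall g, H g -> (g *m y) 0 0 \is a Num.int) ->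
  (forall t : R, closure H (t *: v)) -> v *m y = 0.
Proof.
move=> Hy clv; rewrite [v *m y]mx11_scalar; set z := (v *m y) 0 0.
have [->|z0] := eqVneq z 0; first by rewrite raddf0.
have h0 : 0 < 2^-1 :> R by rewrite invr_gt0.
have [g /Hy/intrP[m gm]] := closure_mulmx _ _ _ _ y _ _ (clv (2^-1 / z)) h0.
move=> /(mx_norm_ltP _ _ _ _ _ h0).1/(_ 0 0).
have -> : ((2^-1 / z *: v) *m y - g *m y) 0 0 = 2^-1 - m%:~R.
  rewrite -scalemxAl mxE [X in X + _]mxE -/z divfK//; congr (_ + _).
  by rewrite mxE gm.
rewrite ltr_norml => /andP[h1 h2].
have m0 : 0 < m by rewrite -(ltr0z R); lra.
have m1 : m < 1 by rewrite -(ltrz1 R); lra.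
by move: m0; rewrite gtz0_ge1 leNgt m1.
Qed.

End ClosureFunctionals.

(** * Rational forms and the relations encoded by the vectors [uprime] *)

Lemma common_denominator (T : finType) (F : T -> rat) :
  exists2 D : nat, (0 < D)%N & forall x, D%:R * F x \is a Num.int.
Proof.
exists (\prod_x `|denq (F x)|)%N => [|x].
  by rewrite prodn_gt0// => x; rewrite absz_gt0 denq_neq0.
rewrite (bigD1 x)//= natrM mulrAC rpredM ?rpred_nat//.
rewrite -[X in _ * X]divq_num_den mulrC pmulrn absz_denq divfK ?intr_int//.
by rewrite intr_eq0 denq_neq0.
Qed.

Section Relations.
Context {R : realType} {q r : nat}.
Variables (alpha : 'I_r -> 'I_q -> R) (I : 'I_r -> {set 'I_q}).
Variables (t : 'I_r -> 'I_q -> rat) (gamma : 'I_r -> 'I_q -> 'I_q -> rat).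
Hypothesis hgamma : forall k j, j \notin I k ->
  alpha k j = ratr (t k j) + \sum_(i in I k) ratr (gamma k j i) * alpha k i.

(** Substituting [hgamma] for the dependent coordinates separates a rational constant from a
    combination of the independent [alpha k j], the form to which [Qfree_with1] applies. *)
Lemma rat_form_alpha k (y : 'I_q -> rat) :
  \sum_i ratr (y i) * alpha k i =
  ratr (\sum_(i | i \notin I k) y i * t k i) +
  \sum_(j in I k) ratr (y j + \sum_(i | i \notin I k) y i * gamma k i j) * alpha k j.
Proof.
rewrite (bigID (mem (I k)))/= addrC.
rewrite (eq_bigr (fun i => ratr (y i * t k i) +
   \sum_(j in I k) ratr (y i * gamma k i j) * alpha k j)); last first.
  move=> i iI; rewrite hgamma// mulrDr rmorphM mulr_sumr; congr (_ + _).
  by apply: eq_bigr => j _; rewrite mulrA rmorphM.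
rewrite big_split/= raddf_sum/= -addrA; congr (_ + _).
rewrite exchange_big/= -big_split/=; apply: eq_bigr => j _.
by rewrite rmorphD raddf_sum mulrDl mulr_suml addrC.
Qed.

Variables (N : nat) (mm : 'I_r -> 'I_q -> 'I_q -> int).
Hypothesis hN : (0 < N)%N.
Hypothesis hmm : forall k i j, i \notin I k -> j \in I k ->
  N%:Q * gamma k i j = (mm k i j)%:~R.

(** These are the coordinates of [uprime u I N mm k j] in the family [u], kept over [rat] so that
    kernels can be computed over the rationals. *)
Definition relation_row k j : 'rV[rat]_q :=
  N%:R *: delta_mx 0 j + \sum_(i | i \notin I k) (mm k i j)%:~R *: delta_mx 0 i.

(* The rows of index [j \notin I k] are padded by zero. *)
Definition relation_mx : 'M[rat]_(#|{: 'I_r * 'I_q}|, q) :=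
  \matrix_p (let: (k, j) := enum_val p in if j \in I k then relation_row k j else 0).

Lemma relation_row_mul k j (y : 'cV[rat]_q) : j \in I k ->
  relation_row k j *m y =
  (N%:R * (y j 0 + \sum_(i | i \notin I k) y i 0 * gamma k i j))%:M.
Proof.
move=> jI; rewrite [LHS]mx11_scalar; congr _%:M.
rewrite mulmxDl -scalemxAl -rowE mulmx_suml !mxE mulrDr; congr (_ + _).
rewrite summxE mulr_sumr; apply: eq_bigr => i iI.
by rewrite -scalemxAl -rowE !mxE -hmm// -pmulrn; ring.
Qed.

Lemma relation_row_eq0 k j (y : 'cV[rat]_q) : j \in I k ->
  (relation_row k j *m y = 0) <-> (y j 0 + \sum_(i | i \notin I k) y i 0 * gamma k i j = 0).
Proof.
move=> jI; rewrite relation_row_mul//; split=> [/matrixP/(_ 0 0)|->].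
  rewrite !mxE mulr1n => /eqP; rewrite mulf_eq0 pnatr_eq0 (gtn_eqF hN)/=.
  by move/eqP.
by rewrite mulr0 raddf0.
Qed.

Lemma relation_mx_eq0 (y : 'cV[rat]_q) :
  (relation_mx *m y = 0) <-> (forall k j, j \in I k -> relation_row k j *m y = 0).
Proof.
split=> [Ay k j jI|Hy].
  have := congr1 (row (enum_rank (k, j))) Ay.
  by rewrite row_mul rowK enum_rankK jI row0.
apply/row_matrixP => p; rewrite row_mul rowK row0.
by case: (enum_val p) => k j; case: ifP => [/Hy|_]; rewrite ?mul0mx.
Qed.

Lemma LMH_relation_mx n (u : 'I_q -> 'rV[R]_n) :
  (\sum_(k < r) \sum_(j in I k) <<uprime u I N mm k j>> :=:
    map_mx ratr relation_mx *m \matrix_j u j)%MS.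
Proof.
have uprimeE k j : uprime u I N mm k j =
    map_mx ratr (relation_row k j) *m \matrix_j u j.
  rewrite /uprime /relation_row map_mxD map_mxZ map_delta_mx mulmxDl /= ratr_nat.
  rewrite -scalemxAl -rowE rowK; congr (_ + _).
  rewrite raddf_sum mulmx_suml; apply: eq_bigr => i _.
  by rewrite /= map_mxZ map_delta_mx /= ratr_int -scalemxAl -rowE rowK.
apply/eqmxP/andP; split.
  apply/sumsmx_subP => k _; apply/sumsmx_subP => j jI; rewrite genmxE uprimeE.
  rewrite (_ : relation_row k j = row (enum_rank (k, j)) relation_mx).
    by rewrite map_row -row_mul row_sub.
  by rewrite rowK enum_rankK jI.
apply/row_subP => p; rewrite row_mul -map_row rowK.
case: (enum_val p) => k j; case: ifP => [jI|_]; last by rewrite map_mx0 mul0mx sub0mx.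
by rewrite (sumsmx_sup k)// (sumsmx_sup j)// genmxE uprimeE.
Qed.

End Relations.

(** * The largest subspace in the closure of the generated subgroup *)

Lemma is_subgroup_gen (R : realType) (n q r : nat)
    (u : 'I_q -> 'rV[R]_n) (w : 'I_r -> 'rV[R]_n) :
  is_subgroup _ (gen_subgroup u w).
Proof.
split; first by exists (fun=> 0), (fun=> 0); rewrite !big1 ?addr0// => i _; rewrite mulr0z.
move=> _ _ [a [b ->]] [a' [b' ->]].
exists (fun j => a j - a' j), (fun k => b k - b' k).
rewrite opprD addrACA -!sumrB.
by congr (_ + _); apply: eq_bigr => i _; rewrite mulrzBr.
Qed.

Section MaximalSubspace.
Context {R : realType} {n q r : nat}.
Variables (u : 'I_q -> 'rV[R]_n) (w : 'I_r -> 'rV[R]_n).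
Variables (alpha : 'I_r -> 'I_q -> R) (I : 'I_r -> {set 'I_q}).
Variables (t : 'I_r -> 'I_q -> rat) (gamma : 'I_r -> 'I_q -> 'I_q -> rat).
Variables (N : nat) (mm : 'I_r -> 'I_q -> 'I_q -> int).
Hypothesis hfree : row_free (\matrix_(j < q) u j).
Hypothesis halpha : forall k, w k = \sum_(j < q) alpha k j *: u j.
Hypothesis hIfree : forall k, Qfree_with1 (I k) (alpha k).
Hypothesis hgamma : forall k j, j \notin I k ->
  alpha k j = ratr (t k j) + \sum_(i in I k) ratr (gamma k j i) * alpha k i.
Hypothesis hN : (0 < N)%N.
Hypothesis hmm : forall k i j, i \notin I k -> j \in I k ->
  N%:Q * gamma k i j = (mm k i j)%:~R.

Let U := \matrix_(j < q) u j.
Let A := relation_mx I N mm.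

Lemma gen_basisE j : u j = delta_mx 0 j *m U.
Proof. by rewrite -rowE rowK. Qed.

Lemma gen_otherE k : w k = (\row_j alpha k j) *m U.
Proof.
by rewrite halpha mulmx_sum_row; apply: eq_bigr => j _; rewrite mxE rowK.
Qed.

Lemma gen_basis_in j : gen_subgroup u w (u j).
Proof.
exists (fun i => (i == j)%:Z), (fun=> 0).
rewrite [X in _ + X]big1 => [|i _]; last by rewrite mulr0z.
by rewrite (bigD1 j)//= eqxx big1 ?addr0// => i /negbTE ->; rewrite mulr0z.
Qed.

Lemma gen_other_in k : gen_subgroup u w (w k).
Proof.
exists (fun=> 0), (fun i => (i == k)%:Z).
rewrite [X in X + _]big1 => [|i _]; last by rewrite mulr0z.
by rewrite (bigD1 k)//= eqxx big1 ?addr0 ?add0r// => i /negbTE ->; rewrite mulr0z.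
Qed.

Lemma form_alphaE k (y : 'cV[rat]_q) :
  ((\row_j alpha k j) *m map_mx ratr y) 0 0 = \sum_i ratr (y i 0) * alpha k i.
Proof. by rewrite mxE; apply: eq_bigr => i _; rewrite !mxE mulrC. Qed.

(** By duality in the coordinates of [u], it suffices that every form integral on the closure kills
    the relation rows. *)
Lemma relation_space_in_closure v :
  (v <= map_mx ratr A *m U)%MS -> closure (gen_subgroup u w) v.
Proof.
move=> /submxP[a ->]; rewrite mulmxA.
pose G := [set c : 'rV[R]_q | closure (gen_subgroup u w) (c *m U)].
have subH := is_subgroup_closure _ _ _ (is_subgroup_gen _ _ _ _ u w).
apply: (closed_subgroup_dual _ _ G).
- split; first by rewrite /G /= mul0mx; exact: subH.1.
  by move=> c d Gc Gd; rewrite /G/= mulmxBl; exact: subH.2.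
- move=> c Gc; rewrite /G/= (closure_id (closure _)).1; last exact: closed_closure.
  apply/closure_normP => e e0.
  by have [g Gg cg] := closure_mulmx _ _ _ _ U _ _ Gc e0; exists (g *m U).
- move=> i; rewrite /G/= -gen_basisE; exact/subset_closure/gen_basis_in.
move=> y yG.
(* Testing the form on the basis vectors [u i] shows that its coefficients are integers. *)
have /choice[m ym] i : exists m : int, y i 0 = m%:~R.
  apply/intrP; have := yG (delta_mx 0 i); rewrite -rowE mxE; apply.
  by rewrite /G/= -gen_basisE; exact/subset_closure/gen_basis_in.
pose yQ : 'cV[rat]_q := \col_i (m i)%:~R.
have yE : y = map_mx ratr yQ.
  by apply/colP => i; rewrite !mxE ratr_int.
suff AyQ : A *m yQ = 0 by rewrite yE -mulmxA -map_mxM AyQ map_mx0 mulmx0.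
apply/relation_mx_eq0 => k j jI; apply/(relation_row_eq0 _ _ _ _ hN hmm) => //.
have /intrP[b] : ((\row_j alpha k j) *m y) 0 0 \is a Num.int.
  apply: yG; rewrite /G/= -gen_otherE; exact/subset_closure/gen_other_in.
rewrite yE form_alphaE (rat_form_alpha _ _ _ _ hgamma) => e.
(* Integrality at [w k] gives a rational relation between 1 and the independent [alpha k j], so each
   [c j] with [j] in [I k] vanishes; this is the required equation. *)
pose c0 := \sum_(i | i \notin I k) yQ i 0 * t k i - b%:~R.
pose c j := yQ j 0 + \sum_(i | i \notin I k) yQ i 0 * gamma k i j.
have [|_] := hIfree k c0 c; last exact.
by rewrite rmorphB/= ratr_int addrAC -[in X in _ - X]e subrr.
Qed.

(** The relation space is cut out by rational forms; after clearing denominators these are integral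
    on the subgroup, so they vanish on every line in its closure. *)
Lemma subspace_in_closure_le (V : 'M[R]_n) :
  subspace_in V (closure (gen_subgroup u w)) -> (V <= map_mx ratr A *m U)%MS.
Proof.
move=> VH; apply/row_subP => i; set v := row i V.
have vH (s : R) : closure (gen_subgroup u w) (s *: v).
  by apply: VH; rewrite scalemx_sub// row_sub.
have vU : (v <= U)%MS.
  suff : (v <= <<U>>)%MS by rewrite genmxE.
  apply: (closure_submx _ _ (gen_subgroup u w)).
    move=> _ [a [b ->]]; rewrite genmxE.
    rewrite addmx_sub// summx_sub// => j _; rewrite -scaler_int scalemx_sub//.
      by rewrite gen_basisE submxMl.
    by rewrite gen_otherE submxMl.
  by rewrite -[v]scale1r.
(* This reduces to the coordinates of [v]; the cokernel of [A] commutes with [map_mx ratr], so its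
   columns are rational forms. *)
rewrite -(mulmxKpV vU) submxMr// submxE -map_cokermx.
apply/eqP/matrixP => i0 l; rewrite [i0]ord1 {i0}.
pose y := col l (cokermx A).
have Ay : A *m y = 0 by rewrite -col_mulmx mulmx_coker col0.
have alphay k : ((\row_j alpha k j) *m map_mx ratr y) 0 0 =
    ratr (\sum_(i | i \notin I k) y i 0 * t k i).
  rewrite form_alphaE (rat_form_alpha _ _ _ _ hgamma) [X in _ + X]big1 ?addr0// => j jI.
  have /(relation_row_eq0 _ _ _ _ hN hmm) -> // : relation_row I N mm k j *m y = 0.
    exact: (relation_mx_eq0 _ _ _ _).1.
  by rewrite rmorph0 mul0r.
(* [D1] makes the form integral on the [u j], and [D2] makes it integral on the [w k]. *)
have [D1 D1_gt0 D1y] := common_denominator _ (fun i => y i 0).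
have [D2 D2_gt0 D2y] := common_denominator _
  (fun k => \sum_(i | i \notin I k) y i 0 * t k i).
pose D := (D1 * D2)%N.
have D0 : D%:R != 0 :> R by rewrite pnatr_eq0 -lt0n muln_gt0 D1_gt0.
have ratr_int_form (x : rat) : D%:R * x \is a Num.int -> D%:R * ratr x \is a @Num.int R.
  by move=> /intrP[m e]; rewrite -(ratr_nat R D) -rmorphM/= e ratr_int intr_int.
(* Since [U] is row free, [pinvmx U] is a right inverse and extends the form from coordinates to the
   ambient space. *)
pose Y := pinvmx U *m (D%:R *: map_mx ratr y).
have UY : U *m Y = D%:R *: map_mx ratr y by rewrite mulmxA mulmxVp// mul1mx.
have uY j : (u j *m Y) 0 0 \is a Num.int.
  rewrite gen_basisE -mulmxA UY -scalemxAr -rowE 3!mxE; apply: ratr_int_form.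
  by rewrite natrM mulrAC rpredM ?rpred_nat.
have wY k : (w k *m Y) 0 0 \is a Num.int.
  rewrite gen_otherE -mulmxA UY -scalemxAr mxE alphay; apply: ratr_int_form.
  by rewrite natrM -mulrA rpredM ?rpred_nat.
have : v *m Y = 0.
  apply: int_form_line_closure vH => _ [a [b ->]].
  rewrite mulmxDl !mulmx_suml mxE !summxE rpredD// rpred_sum// => j _.
    by rewrite -scaler_int -scalemxAl mxE rpredM// intr_int.
  by rewrite -scaler_int -scalemxAl mxE rpredM// intr_int.
rewrite mulmxA -scalemxAr map_col -col_mulmx => /eqP.
rewrite scaler_eq0 (negbTE D0)/= => /eqP/colP/(_ 0).
by rewrite mxE [RHS]mxE => ->; rewrite mxE.
Qed.

Lemma max_subspace_dim_closure :
  max_subspace_dim (closure (gen_subgroup u w)) = LMH u I N mm.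
Proof.
rewrite /LMH (LMH_relation_mx I N mm _ u).
apply/eqP; rewrite eqn_leq; apply/andP; split.
  apply/bigmax_leqP => k /asboolP[V [<- /subspace_in_closure_le]]; exact: mxrankS.
set X := (X in \rank X).
have rX : (\rank X < n.+1)%N by rewrite ltnS rank_leq_col.
apply: (@leq_bigmax_cond _ _ (fun i : 'I_n.+1 => nat_of_ord i) (Ordinal rX)).
(* The generated-space form [<<X>>] supplies the square matrix demanded by [max_subspace_dim]. *)
apply/asboolP; exists <<X>>%MS; split; first by rewrite mxrank_gen.
by move=> v; rewrite genmxE; exact: relation_space_in_closure.
Qed.

End MaximalSubspace.

Theorem theorem1p5 (R : realType) (n q r : nat)
  (u : 'I_q -> 'rV[R]_n) (w : 'I_r -> 'rV[R]_n)
  (* u_1..u_q is a basis of vect(H), q = dim vect(H) *)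
  (hfree : row_free (\matrix_(j < q) u j))
  (hdim : q = dim_vect (gen_subgroup u w))
  (alpha : 'I_r -> 'I_q -> R)
  (halpha : forall k, w k = \sum_(j < q) alpha k j *: u j)
  (I : 'I_r -> {set 'I_q})
  (hIfree : forall k, Qfree_with1 (I k) (alpha k))
  (hImax : forall k (J : {set 'I_q}), Qfree_with1 J (alpha k) -> (#|J| <= #|I k|)%N)
  (t : 'I_r -> 'I_q -> rat) (gamma : 'I_r -> 'I_q -> 'I_q -> rat)
  (hgamma : forall k j, j \notin I k ->
     alpha k j = ratr (t k j) + \sum_(i in I k) ratr (gamma k j i) * alpha k i)
  (N : nat) (hN : (0 < N)%N) (mm : 'I_r -> 'I_q -> 'I_q -> int)
  (hmm : forall k i j, i \notin I k -> j \in I k -> N%:Q * gamma k i j = (mm k i j)%:~R) :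
  cdim (closure (gen_subgroup u w)) =
    ((LMH u I N mm)%:Z, q%:Z - (LMH u I N mm)%:Z).
Proof.
rewrite /cdim (max_subspace_dim_closure _ _ _ _ _ _ _ _ hfree halpha hIfree hgamma hN hmm).
by rewrite dim_vect_closure -hdim.
Qed.
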